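(* Let $X$ be a finite-dimensional real normed space with closed unit ball $B$ and unit sphere $S$. The following are equivalent: (a) $X$ is boundedly semitransitive. (b) The dual space $X^*$ is boundedly semitransitive. (c) There is a constant $\lambda$ such that every $x\in S$ admits an inner ellipsoid $E$ and an outer ellipsoid $F$ such that $F\subset\lambda E$. (d) $X$ has modulus of uniform convexity of power type $2$ and modulus of uniform smoothness of power type $2$.
   Context: For a normed space $X$ let $\operatorname{Aut}_1(X)$ be the semigroup of invertible bounded linear operators $T:X\to X$ (with bounded inverse) with $\|T\|\le 1$ (operator norm). $X$ is boundedly semitransitive if there is a constant $K$ such that for every $x,y\in S$ there is $T\in\operatorname{Aut}_1(X)$ with $y=Tx$ and $\|T^{-1}\|\le K$. An ellipsoid in a finite-dimensional space $X$ is the closed unit ball (centered at the origin) of a Euclidean norm on $X$ (a norm induced by an inner product). An ellipsoid $E$ is inner at $x\in S$ if $E\subset B$ and $x\in E$; it is outer at $x\in S$ if $B\subset E$ and $x\in\partial E$. The modulus of uniform convexity of $X$ is $\delta_X:(0,2]\to[0,1]$, $\delta_X(\varepsilon)=\inf\{1-\|\tfrac{x+y}{2}\|:\|x-y\|\ge\varepsilon,\ \|x\|,\|y\|\le 1\}$; it is of power type $2$ if there is $c>0$ with $\delta_X(\varepsilon)\ge c\varepsilon^2$ for all $0<\varepsilon\le 2$. The modulus of uniform smoothness is the standard one, $\rho_X(\tau)=\sup\{\tfrac12(\|x+\tau y\|+\|x-\tau y\|)-1:\|x\|=\|y\|=1\}$ for $\tau>0$; it is of power type $2$ if there is $C$ with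 $\rho_X(\tau)\le C\tau^2$ for all $\tau>0$ (equivalently, $X^*$ has modulus of uniform convexity of power type $2$). *)

(* Defs.v *)
From HB Require Import structures.
From mathcomp Require Import all_boot all_order all_algebra.
From mathcomp Require Import all_classical all_reals all_analysis.

Set Implicit Arguments.
Unset Strict Implicit.
Unset Printing Implicit Defensive.
Import Order.TTheory GRing.Theory Num.Theory.
Import numFieldNormedType.Exports.

Local Open Scope classical_set_scope.
Local Open Scope ring_scope.

Definition unit_ball (R : realType) (X : normedModType R) : set X :=
  [set x | `|x| <= 1].

Definition unit_sphere (R : realType) (X : normedModType R) : set X :=
  [set x | `|x| = 1].

Arguments unit_ball {R} X _ /.
Arguments unit_sphere {R} X _ /.

Definition finite_dimensional (R : realType) (X : normedModType R) : Prop :=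
  exists n : nat, inhabited (Vector.axiom n X).

Definition is_bounded_linear (R : realType) (X Y : normedModType R)
    (f : X -> Y) : Prop :=
  linear f /\ exists M : R, forall x, `|f x| <= M * `|x|.

Definition bounded_linear (R : realType) (X Y : normedModType R) :
  {pred X -> Y} := [pred f | `[< is_bounded_linear f >]].

Lemma bounded_linearP (R : realType) (X Y : normedModType R) (f : X -> Y) :
  reflect (is_bounded_linear f) (f \in @bounded_linear R X Y).
Proof. exact: asboolP. Qed.

Lemma bounded_linear_submod_closed (R : realType) (X Y : normedModType R) :
  submod_closed (@bounded_linear R X Y).
Proof.
split=> [|a f g].
  apply/bounded_linearP; split.
    by move=> a x y; change (0 = a *: (0 : Y) + 0); rewrite scaler0 addr0.
  by exists 0 => x; change (`|0 : Y| <= 0 * `|x|); rewrite normr0 mul0r.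
move=> /bounded_linearP[lf [M Mf]] /bounded_linearP[lg [N Ng]].
apply/bounded_linearP; split.
  move=> b x y; rewrite !fctE lf lg !scalerDr !scalerA (mulrC a b) -!scalerA.
  by rewrite addrACA.
exists (`|a| * M + N) => x; rewrite !fctE (le_trans (ler_normD _ _))//.
by rewrite normrZ mulrDl -mulrA lerD// ler_wpM2l.
Qed.

HB.instance Definition _ (R : realType) (X Y : normedModType R) :=
  GRing.isSubmodClosed.Build R (X -> Y) (@bounded_linear R X Y)
    (@bounded_linear_submod_closed R X Y).

Record bounded_op (R : realType) (X Y : normedModType R) := BoundedOp {
  bounded_op_fun :> X -> Y;
  bounded_op_subproof : bounded_op_fun \in @bounded_linear R X Y }.

HB.instance Definition _ (R : realType) (X Y : normedModType R) :=
  [isSub for @bounded_op_fun R X Y].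
HB.instance Definition _ (R : realType) (X Y : normedModType R) :=
  [Choice of bounded_op X Y by <:].
HB.instance Definition _ (R : realType) (X Y : normedModType R) :=
  [SubChoice_isSubLmodule of bounded_op X Y by <:].

Definition op_norm (R : realType) (X Y : normedModType R)
    (f : bounded_op X Y) : R :=
  sup [set `|f x| | x in unit_ball X].

Section op_norm_theory.
Variables (R : realType) (X Y : normedModType R).
Implicit Types f g : bounded_op X Y.

Lemma bounded_op_linear f : linear f.
Proof. by case/bounded_linearP: (bounded_op_subproof f). Qed.

Lemma bounded_op0 f : f 0 = 0.
Proof.
have := bounded_op_linear f 1 0 0; rewrite !scale1r addr0.
by rewrite -[LHS]addr0 => /addrI.
Qed.

Lemma bounded_opZ f a x : f (a *: x) = a *: f x.
Proof. by have := bounded_op_linear f a x 0; rewrite bounded_op0 !addr0. Qed.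

Lemma op_norm_has_sup f : has_sup [set `|f x| | x in unit_ball X].
Proof.
split; first by exists `|f 0|; exists 0 => //; rewrite /unit_ball/= normr0.
have /bounded_linearP[_ [M Mf]] := bounded_op_subproof f.
exists `|M| => _ [x x1 <-]; rewrite (le_trans (Mf x))//.
rewrite (le_trans (ler_wpM2r (normr_ge0 x) (ler_norm M)))//.
by rewrite -[leRHS]mulr1 ler_wpM2l.
Qed.

Lemma op_norm_ball f x : `|x| <= 1 -> `|f x| <= op_norm f.
Proof.
by move=> x1; apply: ub_le_sup; [case: (op_norm_has_sup f)|exists x].
Qed.

Lemma op_norm_le f M : (forall x, `|x| <= 1 -> `|f x| <= M) -> op_norm f <= M.
Proof.
move=> fM; apply: ge_sup; first by case: (op_norm_has_sup f).
by move=> _ [x x1 <-]; exact: fM.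
Qed.

Lemma op_norm_ge0 f : 0 <= op_norm f.
Proof.
by apply: (le_trans (normr_ge0 (f 0))); apply: op_norm_ball; rewrite normr0.
Qed.

Lemma op_normP f x : `|f x| <= op_norm f * `|x|.
Proof.
have [->|x0] := eqVneq x 0; first by rewrite bounded_op0 !normr0 mulr0.
have nx0 : 0 < `|x| by rewrite normr_gt0.
have := @op_norm_ball f (`|x|^-1 *: x).
rewrite bounded_opZ !normrZ normfV normr_id mulVf ?gt_eqF// => /(_ (lexx _)).
by rewrite mulrC ler_pdivrMr.
Qed.

Lemma op_normD f g : op_norm (f + g) <= op_norm f + op_norm g.
Proof.
apply: op_norm_le => x x1 /=.
by rewrite (le_trans (ler_normD _ _))// lerD// op_norm_ball.
Qed.

Lemma op_normZ_le (a : R) f : op_norm (a *: f) <= `|a| * op_norm f.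
Proof.
by apply: op_norm_le => x x1 /=; rewrite normrZ ler_wpM2l// op_norm_ball.
Qed.

Lemma op_normZ (a : R) f : op_norm (a *: f) = `|a| * op_norm f.
Proof.
apply/eqP; rewrite eq_le op_normZ_le/=.
have [->|a0] := eqVneq a 0; first by rewrite normr0 mul0r op_norm_ge0.
rewrite -ler_pdivlMl ?normr_gt0// -normfV.
by rewrite -[in leLHS](scale1r f) -(mulVf a0) -scalerA op_normZ_le.
Qed.

Lemma op_norm0_eq0 f : op_norm f = 0 -> f = 0.
Proof.
move=> f0; apply/val_inj/funext => x /=; apply/eqP.
by rewrite -normr_le0 (le_trans (op_normP f x))// f0 mul0r.
Qed.

HB.instance Definition _ := @Lmodule_isNormed.Build R (bounded_op X Y)
  (@op_norm R X Y) op_normD op_normZ op_norm0_eq0.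

End op_norm_theory.

Definition dual (R : realType) (X : normedModType R) : normedModType R :=
  bounded_op X R^o.

Definition inverse_op (R : realType) (X : normedModType R)
    (T U : bounded_op X X) : Prop :=
  cancel T U /\ cancel U T.

Definition Aut1 (R : realType) (X : normedModType R) : set (bounded_op X X) :=
  [set T | (exists U, inverse_op T U) /\ `|T| <= 1].

Definition boundedly_semitransitive (R : realType) (X : normedModType R) :
    Prop :=
  exists K : R, forall x y : X, unit_sphere X x -> unit_sphere X y ->
    exists T : bounded_op X X,
      [/\ Aut1 T, y = T x & exists2 U, inverse_op T U & `|U| <= K].

(* An inner product on X is a form q : {dot X for idfun}, and the Euclidean
   norm that it induces is x |-> Num.sqrt (q x x). *)
Definition ellipsoid (R : realType) (X : normedModType R) (E : set X) : Prop :=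
  exists q : {dot X for (idfun : R -> R)},
    E = [set x | Num.sqrt (q x x) <= 1].

Definition boundary (T : topologicalType) (A : set T) : set T :=
  closure A `\` interior A.

Definition inner_ellipsoid (R : realType) (X : normedModType R) (x : X)
    (E : set X) : Prop :=
  [/\ ellipsoid E, E `<=` unit_ball X & E x].

Definition outer_ellipsoid (R : realType) (X : normedModType R) (x : X)
    (F : set X) : Prop :=
  [/\ ellipsoid F, unit_ball X `<=` F & boundary F x].

Local Open Scope ereal_scope.

(* Both moduli are extended-real valued only because of the zero space, where
   the infimum and the supremum range over the empty set; for X nonzero and
   0 < eps <= 2 (resp. 0 < tau) they are finite. *)
Definition convexity_modulus (R : realType) (X : normedModType R) (eps : R) :
    \bar R :=
  ereal_inf [set r | exists x y : X,
    [/\ (eps <= `|x - y|)%R, (`|x| <= 1)%R, (`|y| <= 1)%R &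
        r = (1 - `|2^-1 *: (x + y)|)%:E]].

Definition smoothness_modulus (R : realType) (X : normedModType R) (tau : R) :
    \bar R :=
  ereal_sup [set r | exists x y : X,
    [/\ (`|x| = 1)%R, (`|y| = 1)%R &
        r = (2^-1 * (`|x + tau *: y| + `|x - tau *: y|) - 1)%:E]].

Definition convexity_power_type2 (R : realType) (X : normedModType R) : Prop :=
  exists2 c : R, (0 < c)%R & forall eps : R, (0 < eps <= 2)%R ->
    (c * eps ^+ 2)%:E <= convexity_modulus X eps.

Definition smoothness_power_type2 (R : realType) (X : normedModType R) : Prop :=
  exists C : R, forall tau : R, (0 < tau)%R ->
    smoothness_modulus X tau <= (C * tau ^+ 2)%:E.

(* Main.v *)
(* The scheme is (a) => (c) => (d) => (a) for every finite-dimensional space,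
   together with the self-duality of (d).

   (a) => (c): fix a Euclidean norm; by compactness a multiple of its ball is an
   inner ellipsoid at some point u of the sphere and another multiple is an outer
   ellipsoid at some v. Operators of Aut_1 carrying u to x, resp. x to v,
   transport them to an inner and an outer ellipsoid at x.

   (c) => (d): the parallelogram law in the outer ellipsoid at (a + b)/|a + b|
   gives convexity, the one in the inner ellipsoid at x gives smoothness.

   (d) => (a): let f and g support the ball at x and y. Convexity at x gives
   |z|^2 >= f(z)^2 + c' |z - f(z) x|^2 and smoothness at y gives
   |z|^2 <= g(z)^2 + C' |z - g(z) y|^2, so z |-> f(z) y + s H (z - f(z) x) is a
   contraction carrying x to y, where H is a Euclidean reflection exchanging
   ker f and ker g and s > 0 is a small constant.

   Duality of (d) is Lindenstrauss' argument: f(x + y) + g(x - y) =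
   (f + g)(x) + (f - g)(y). Norming functionals come from flattening the norm,
   as a sublinear functional, successively along x and along a basis. *)
Require Import Defs.
From HB Require Import structures.
From mathcomp Require Import all_boot all_order all_algebra.
From mathcomp Require Import all_classical all_reals all_analysis.
From mathcomp Require Import ring lra.

Set Implicit Arguments.
Unset Strict Implicit.
Unset Printing Implicit Defensive.
Import Order.TTheory GRing.Theory Num.Theory.
Import numFieldNormedType.Exports.

Local Open Scope classical_set_scope.
Local Open Scope ring_scope.

(** * Euclidean forms *)

(** The proofs [lA] and [iA] are carried as arguments so that the dot-product structure below can be
    attached to this constant. *)
Definition form_pullback (R : realType) (X Y : lmodType R)
  (e : {dot Y for (idfun : R -> R)}) (A : X -> Y) (lA : linear A)
  (iA : injective A) (z w : X) : R := e (A z) (A w).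

Section FormPullback.
Variables (R : realType) (X Y : lmodType R).
Variables (e : {dot Y for (idfun : R -> R)}) (A : X -> Y).
Variables (lA : linear A) (iA : injective A).
Let A0 : A 0 = 0.
Proof.
have := lA 1 0 0; rewrite !scale1r addr0.
by rewrite -[LHS]addr0 => /addrI.
Qed.

Let pull_bilinear :
  bilinear_for *%R ((idfun : R -> R) \; *%R) (form_pullback e lA iA).
Proof.
split=> u a v w; rewrite /form_pullback lA.
  by rewrite linearDl linearZl_LR.
by rewrite linearDr linearZr_LR.
Qed.

HB.instance Definition _ := bilinear_isBilinear.Build R X X R *%R
  ((idfun : R -> R) \; *%R) (form_pullback e lA iA) pull_bilinear.

Let pull_herm z w :
  form_pullback e lA iA z w = (-1) ^+ false * idfun (form_pullback e lA iA w z).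
Proof. by rewrite /form_pullback hermC. Qed.

HB.instance Definition _ := isHermitianSesquilinear.Build R X false
  (idfun : R -> R) (form_pullback e lA iA) pull_herm.

Let pull_pos z : z != 0 -> 0 < form_pullback e lA iA z z.
Proof.
move=> z0; apply: neq0_dnorm_gt0.
by apply: contra_neq z0 => Az0; apply: iA; rewrite A0.
Qed.

HB.instance Definition _ := isDotProduct.Build R X (form_pullback e lA iA)
  pull_pos.
End FormPullback.

Lemma dot_pullback (R : realType) (X Y : lmodType R)
    (e : {dot Y for (idfun : R -> R)}) (A : X -> Y) :
  linear A -> injective A ->
  exists q : {dot X for (idfun : R -> R)}, forall z w, q z w = e (A z) (A w).
Proof. by move=> lA iA; exists (form_pullback e lA iA). Qed.

Definition row_dot (R : realType) (n : nat) (u v : 'rV[R]_n) : R :=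
  \sum_i u 0 i * v 0 i.

Section RowDot.
Variables (R : realType) (n : nat).

Let row_dot_sym (u v : 'rV[R]_n) :
  row_dot u v = (-1) ^+ false * idfun (row_dot v u).
Proof. by rewrite expr0 mul1r; apply: eq_bigr => i _; rewrite mulrC. Qed.

Let row_dot_bilinear :
  bilinear_for *%R ((idfun : R -> R) \; *%R) (@row_dot R n).
Proof.
have linl (u : 'rV[R]_n) a v w :
    row_dot (a *: v + w) u = a * row_dot v u + row_dot w u.
  rewrite mulr_sumr -big_split; apply: eq_bigr => i _.
  by rewrite !mxE mulrDl mulrA.
split=> u a v w; first exact: linl.
by rewrite ![row_dot u _]row_dot_sym !expr0 !mul1r; exact: linl.
Qed.

HB.instance Definition _ := bilinear_isBilinear.Build R 'rV[R]_n 'rV[R]_n R *%R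
  ((idfun : R -> R) \; *%R) (@row_dot R n) row_dot_bilinear.

HB.instance Definition _ := isHermitianSesquilinear.Build R 'rV[R]_n false
  (idfun : R -> R) (@row_dot R n) row_dot_sym.

Let row_dot_pos (u : 'rV[R]_n) : u != 0 -> 0 < row_dot u u.
Proof.
move=> u0; rewrite lt_def sumr_ge0 ?andbT => [|i _]; last first.
  by rewrite -expr2 sqr_ge0.
apply: contra_neq u0 => /eqP; rewrite psumr_eq0 => [|i _]; last first.
  by rewrite -expr2 sqr_ge0.
move=> /allP u0; apply/rowP => i; rewrite mxE; apply/eqP.
by have := u0 i (mem_index_enum i); rewrite mulf_eq0 orbb.
Qed.

HB.instance Definition _ := isDotProduct.Build R 'rV[R]_n (@row_dot R n)
  row_dot_pos.
End RowDot.

Section DotTheory.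
Variables (R : realType) (X : lmodType R) (e : {dot X for (idfun : R -> R)}).
Implicit Types x y z : X.

Lemma dotC x y : e x y = e y x.
Proof. by rewrite hermC expr0 mul1r. Qed.

Lemma dotDl x y z : e (x + y) z = e x z + e y z.
Proof. by rewrite linearDl. Qed.

Lemma dotDr x y z : e x (y + z) = e x y + e x z.
Proof. by rewrite linearDr. Qed.

Lemma dotZl a x y : e (a *: x) y = a * e x y.
Proof. by rewrite linearZl_LR. Qed.

Lemma dotZr a x y : e x (a *: y) = a * e x y.
Proof. by rewrite linearZr_LR. Qed.

Lemma dotBl x y z : e (x - y) z = e x z - e y z.
Proof. by rewrite linearBl. Qed.

Lemma dotBr x y z : e x (y - z) = e x y - e x z.
Proof. by rewrite linearBr. Qed.

Lemma dot_sqrZ a x : e (a *: x) (a *: x) = a ^+ 2 * e x x.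
Proof. by rewrite dotZl dotZr mulrA expr2. Qed.

Lemma dot_gt0 x : x != 0 -> 0 < e x x.
Proof. exact: neq0_dnorm_gt0. Qed.

Lemma dot_ge0 x : 0 <= e x x.
Proof.
by have [->|/dot_gt0/ltW//] := eqVneq x 0; rewrite linear0l.
Qed.

Lemma dot_eq0 x : e x x = 0 -> x = 0.
Proof. by move=> e0; apply/eqP; case: eqVneq => // /dot_gt0; rewrite e0 ltxx. Qed.

Lemma dot_sqrD x y : e (x + y) (x + y) = e x x + 2 * e x y + e y y.
Proof. by rewrite dotDl !dotDr (dotC y x);  ring. Qed.

Lemma dot_sqrB x y : e (x - y) (x - y) = e x x - 2 * e x y + e y y.
Proof. by rewrite dotBl !dotBr (dotC y x);  ring. Qed.

Lemma dot_parallelogram x y :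
  e (x + y) (x + y) + e (x - y) (x - y) = 2 * (e x x + e y y).
Proof. by rewrite dot_sqrD dot_sqrB; ring. Qed.

(** [H] is the reflection in the hyperplane orthogonal to [r - s]. As [r] and [s] have equal length,
    it exchanges them; being self-adjoint, it satisfies [e s (H z) = e (H s) z = e r z]. *)
Lemma dot_reflection r s : e r r = e s s -> exists H : X -> X,
  [/\ linear H, involutive H, forall z, e (H z) (H z) = e z z &
      forall z, e s (H z) = e r z].
Proof.
move=> rs; have [n nE] : exists n, n = r - s by exists (r - s).
(* For r = s the quotient is 0/0 = 0 and the reflection is the identity. *)
pose k z := 2 * e n z / e n n.
exists (fun z => z - k z *: n).
have kn z : k z * e n n = 2 * e n z.
  have [n0|n0] := eqVneq (e n n) 0; last by rewrite /k divfK.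
  by rewrite n0 mulr0 (dot_eq0 n0) linear0l mulr0.
have lk a z w : k (a *: z + w) = a * k z + k w.
  by rewrite /k dotDr dotZr ; ring.
have ens z : k z * e n s = - e n z.
  have -> : e n s = - (e n n / 2).
    by rewrite nE dot_sqrB dotBl -rs; field.
  by rewrite mulrN mulrA kn; field.
split=> [a z w|z|z|z].
- rewrite lk scalerDl scalerBr. rewrite -scalerA opprD addrACA.
  by [].
- have -> : k (z - k z *: n) = - k z.
    have kk : k z * k n = 2 * k z.
      have [n0|n0] := eqVneq (e n n) 0; last by rewrite [k n]/k mulfK// mulrC.
      by rewrite /k n0 invr0 !mulr0.
    by rewrite addrC -scaleNr lk mulNr kk; ring.
  by rewrite scaleNr opprK subrK.
- rewrite dot_sqrB dot_sqrZ dotZr expr2 -mulrA kn (dotC z n); ring.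
- rewrite dotBr dotZr /= (dotC s n) ens opprK nE dotBl; ring.
Qed.

End DotTheory.

Lemma dot_CauchySchwarz (R : realType) (X : lmodType R)
    (e : {dot X for (idfun : R -> R)}) x y : e x y ^+ 2 <= e x x * e y y.
Proof.
have [->|y0] := eqVneq y 0; first by rewrite linear0r expr0n/= mulr_ge0 ?dot_ge0.
have eyy := dot_gt0 e y0.
(* This vector is [e y y] times the component of [x] orthogonal to [y]. *)
have := dot_ge0 e (e y y *: x - e x y *: y).
rewrite dot_sqrB !dot_sqrZ dotZl dotZr.
have -> : e y y ^+ 2 * e x x - 2 * (e y y * (e x y * e x y)) + e x y ^+ 2 * e y y
   = e y y * (e x x * e y y - e x y ^+ 2) by ring.
by rewrite pmulr_rge0// subr_ge0.
Qed.

(** * Norming functionals *)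

Definition sublinear (R : realType) (V : lmodType R) (p : V -> R) : Prop :=
  (forall x y, p (x + y) <= p x + p y) /\
  (forall t x, 0 <= t -> p (t *: x) = t * p x).

Section Sublinear.
Variables (R : realType) (V : lmodType R).
Implicit Types (p q : V -> R) (x y z : V).

Lemma sublinear0 p : sublinear p -> p 0 = 0.
Proof. by case=> _ pZ; have := pZ 0 0 (lexx _); rewrite scale0r mul0r. Qed.

(* The witness is the greatest sublinear q <= p such that q (- y) <= - p y,
   namely q z = inf_(t >= 0) (p (z + t y) - t p y). *)
Lemma sublinear_flatten p y : sublinear p -> exists q,
  [/\ sublinear q, forall z, q z <= p z & q (- y) <= - p y].
Proof.
move=> sp; have p0 := sublinear0 sp; case: sp => pD pZ.
pose A z := [set p (z + t *: y) - t * p y | t in [set t : R | 0 <= t]].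
(* Subadditivity on [t y = (z + t y) + (- z)] bounds the infimum from below. *)
have Albd z : lbound (A z) (- p (- z)).
  move=> _ [t t0 <-]; rewrite lerBrDr addrC lerBlDr -pZ//.
  by rewrite (le_trans _ (pD _ _))// addrAC subrr add0r.
have A0 z : A z !=set0 by exists (p (z + 0 *: y) - 0 * p y); exists 0 => /=.
have Ainf z : has_inf (A z) by split => //; exists (- p (- z)); exact: Albd.
have infA z t : 0 <= t -> inf (A z) <= p (z + t *: y) - t * p y.
  by move=> t0; apply: ge_inf; [case: (Ainf z)|exists t].
have le_infA z m : (forall t, 0 <= t -> m <= p (z + t *: y) - t * p y) ->
    m <= inf (A z).
  by move=> mA; apply: lb_le_inf => // _ [t t0 <-]; exact: mA.
exists (fun z => inf (A z)); split.
- split=> [z w|a z].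
    rewrite -lerBlDr; apply: (le_infA) => t t0.
    rewrite lerBlDl -lerBlDr; apply: (le_infA) => s s0.
    rewrite lerBlDr (le_trans (infA _ (s + t) (addr_ge0 s0 t0)))//.
    have := pD (z + t *: y) (w + s *: y).
    by rewrite addrACA -scalerDl (addrC t s); lra.
  (* For [a > 0] the parameters for [z] and [a z] correspond under [t] to [a t]; this rescaling
     fails at [a = 0]. *)
  rewrite le_eqVlt => /predU1P[<-|a0].
    rewrite mul0r scale0r; apply/eqP; rewrite eq_le; apply/andP; split.
      by have := infA 0 0 (lexx _); rewrite scale0r addr0 p0 mul0r subr0.
    by apply: (le_infA) => t t0; rewrite add0r pZ// subrr.
  have aN0 : a != 0 by rewrite gt_eqF.
  apply/eqP; rewrite eq_le; apply/andP; split.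
    rewrite mulrC -ler_pdivrMr//; apply: (le_infA) => t t0.
    rewrite ler_pdivrMr// (le_trans (infA _ (a * t) (mulr_ge0 (ltW a0) t0)))//.
    by rewrite -scalerA -scalerDr pZ ?(ltW a0)//; lra.
  apply: (le_infA) => t t0.
  rewrite mulrC -ler_pdivlMr// (le_trans (infA _ (a^-1 * t) _))//.
    by rewrite mulr_ge0 ?invr_ge0 ?(ltW a0).
  rewrite ler_pdivlMr// mulrBl [p _ * a]mulrC -(pZ a _ (ltW a0))//.
  rewrite scalerDr !scalerA mulrA divff// mul1r.
  by rewrite mulrAC [_ * t * a]mulrAC mulVf// mul1r.
- by move=> z; have := infA z 0 (lexx _); rewrite scale0r addr0 mul0r subr0.
- by have := infA (- y) 1 ler01; rewrite scale1r addNr p0 mul1r sub0r.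
Qed.

(** Oddness along earlier vectors survives later flattenings: when [q] decreases, [q (- y)]
    decreases and [- q y] increases. *)
Lemma sublinear_flatten_seq p (s : seq V) : sublinear p -> exists q,
  [/\ sublinear q, forall z, q z <= p z & forall y, y \in s -> q (- y) <= - q y].
Proof.
move=> sp; elim: s => [|y s [q [sq qp qs]]]; first by exists p.
have [r [sr rq ry]] := sublinear_flatten y sq.
exists r; split=> // [z|z]; first exact: le_trans (rq z) (qp z).
rewrite inE => /predU1P[->|zs]; first by rewrite (le_trans ry)// lerN2.
by rewrite (le_trans (rq _))// (le_trans (qs _ zs))// lerN2.
Qed.

(** If [q] is odd along [z], then [q w <= q (- z) + q (z + w)] makes it additive between [z] and any
    [w]. So the set [D] of such [z] is stable under linear combinations, and it contains a spanning
    family. *)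
Lemma sublinear_span_linear n (q : V -> R) (b : 'I_n -> V) (c : 'I_n -> V -> R) :
  sublinear q -> (forall z, z = \sum_i c i z *: b i) ->
  (forall i, q (- b i) <= - q (b i)) -> linear (q : V -> R^o).
Proof.
move=> sq bc qb; have q0 := sublinear0 sq; case: sq => qD qZ.
have qNge z : - q z <= q (- z).
  by have := qD z (- z); rewrite subrr q0; lra.
pose D := [set z | q (- z) <= - q z].
have DN z : D z -> q (- z) = - q z.
  by move=> Dz; apply/eqP; rewrite eq_le qNge andbT.
have DD z w : D z -> q (z + w) = q z + q w.
  move=> Dz; apply/eqP; rewrite eq_le qD/=.
  by have := qD (- z) (z + w); rewrite addrA addNr add0r (DN _ Dz); lra.
have DZ a z : D z -> q (a *: z) = a * q z.
  move=> Dz; have [a0|a0] := leP 0 a; first exact: qZ.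
  by rewrite -[a]opprK scaleNr -scalerN qZ ?oppr_ge0 ?ltW// (DN _ Dz); ring.
have DT z : D z.
  rewrite (bc z); elim/big_rec: _ => [|i x _ Dx]; first by rewrite /D/= oppr0 q0 oppr0.
  rewrite /D/= opprD (le_trans (qD _ _))// (DN _ Dx).
  have Db : D (b i) by exact: qb.
  rewrite -scaleNr !DZ// [in leRHS]addrC DD// DZ//; lra.
by move=> a x y; rewrite DD//= DZ.
Qed.

End Sublinear.

(** * Coordinates, compactness and boundedness in finite dimension *)

Lemma finite_dimensional_coords (R : realType) (X : normedModType R) :
  finite_dimensional X -> exists n (V : X -> 'rV[R]_n) (W : 'rV[R]_n -> X),
    [/\ linear V, linear W, cancel V W & cancel W V].
Proof.
move=> [n [[V lV [W VK WK]]]]; exists n, V, W; split=> // a u v.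
by rewrite -[in LHS](WK u) -[in LHS](WK v) -lV VK.
Qed.

Lemma linear_sum_scale (R : realType) (U V : lmodType R) (f : U -> V) n
    (a : 'I_n -> R) (u : 'I_n -> U) :
  linear f -> f (\sum_i a i *: u i) = \sum_i a i *: f (u i).
Proof.
move=> lf; pose g : {linear U -> V} := HB.pack f (GRing.isLinear.Build _ _ _ _ f lf).
by rewrite -[f]/(g : U -> V) linear_sum; apply: eq_bigr => i _; rewrite linearZ.
Qed.

Lemma row_dot_unit_compact (R : realType) n :
  compact [set u : 'rV[R]_n | row_dot u u = 1].
Proof.
apply: bounded_closed_compact.
  exists 1; split; first exact: num_real.
  move=> M M1 u /= u1; rewrite (le_trans _ (ltW M1))//.
  (* The norm of a row is the maximum of its absolute entries, each at most the Euclidean length. *)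
  rewrite [leLHS]/Num.norm/= mx_normrE.
  apply/bigmax_leP; split=> // -[i j] _ /=; rewrite (ord1 i).
  rewrite -(@ler_pXn2r _ 2)// ?nnegrE// expr1n real_normK ?num_real//.
  rewrite -u1 /row_dot (bigD1 j)//= -expr2 lerDl sumr_ge0// => k _.
  by rewrite -expr2 sqr_ge0.
have sqc i : continuous (fun u : 'rV[R]_n => u 0 i * u 0 i).
  by move=> u; apply: continuousM; exact: coord_continuous.
have cont : continuous (fun u : 'rV[R]_n => row_dot u u).
  apply: continuous_big => [|i _]; first exact: add_continuous.
  exact: sqc.
have -> : [set u : 'rV[R]_n | row_dot u u = 1] =
    (fun u => row_dot u u) @^-1` [set 1] by [].
by apply: preimage_closed => //; exact: closed_eq.
Qed.

Lemma row_linear_continuous (R : realType) n (Y : normedModType R)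
    (W : 'rV[R]_n -> Y) : linear W -> continuous W.
Proof.
move=> lW.
have -> : W = fun u => \sum_i u 0 i *: W (delta_mx 0 i).
  by apply/funext => u; rewrite [in LHS](row_sum_delta u) linear_sum_scale.
have cW i : continuous (fun u : 'rV[R]_n => u 0 i *: W (delta_mx 0 i)).
  by move=> u; apply: continuousZr_tmp; exact: coord_continuous.
apply: continuous_big => [|i _]; first exact: add_continuous.
exact: cW.
Qed.

(* The extrema of the norm on the Euclidean unit sphere, rescaled to the
   unit sphere of the norm. *)
Lemma euclidean_extremals (R : realType) (X : normedModType R) :
  finite_dimensional X -> exists e : {dot X for (idfun : R -> R)},
    (forall f : X -> R^o, linear f -> exists p, forall z, f z = e p z) /\
    forall x : X, `|x| = 1 -> exists u v : X, [/\ `|u| = 1, `|v| = 1 &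
      forall z : X, e u u * `|z| ^+ 2 <= e z z <= e v v * `|z| ^+ 2].
Proof.
move=> /finite_dimensional_coords[n [V [W [lV lW VK WK]]]].
have [e eE] := dot_pullback (@row_dot R n) lV (can_inj VK).
exists e; split=> [f lf|x x1].
  (* The Riesz vector of [f] has the values of [f] on the basis as coordinates. *)
  exists (W (\row_i f (W (delta_mx 0 i)))) => z; rewrite eE WK.
  rewrite -[in LHS](VK z) [in LHS](row_sum_delta (V z)) !linear_sum_scale//.
  by apply: eq_bigr => i _; rewrite mxE mulrC.
have x0 : x != 0 by rewrite -normr_gt0 x1.
pose A := [set u : 'rV[R]_n | row_dot u u = 1].
have AW z : z != 0 -> A (V ((Num.sqrt (e z z))^-1 *: z)).
  move=> z0; rewrite /A/= -eE dot_sqrZ exprVn sqr_sqrtr ?dot_ge0// mulVf//.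
  by rewrite gt_eqF// dot_gt0.
have A0 : A !=set0 by exists (V ((Num.sqrt (e x x))^-1 *: x)); exact: AW.
have cf : {within A, continuous (fun u => `|W u|)}.
  apply: continuous_subspaceT => u.
  apply: continuous_comp; first exact: row_linear_continuous.
  exact: norm_continuous.
(* The largest norm on the Euclidean sphere gives, after rescaling, the unit vector [u] of least
   Euclidean length; the smallest norm gives [v]. *)
have [um umA umP] := EVT_max_rV A0 (@row_dot_unit_compact R n) cf.
have [vm vmA vmP] := EVT_min_rV A0 (@row_dot_unit_compact R n) cf.
have key w : w \in A -> 0 < `|W w| /\ e (W w) (W w) = 1.
  rewrite inE => Aw; have ew : e (W w) (W w) = 1 by rewrite eE WK.
  split=> //; rewrite normr_gt0; apply/eqP => w0.
  by move: ew => /eqP; rewrite w0 linear0l eq_sym oner_eq0.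
have [u0 ue] := key _ umA; have [v0 ve] := key _ vmA.
have n1 w : 0 < `|w| -> `|(`|w|^-1 *: w : X)| = 1.
  by move=> w0; rewrite normrZ normfV normr_id mulVf// gt_eqF.
exists (`|W um|^-1 *: W um), (`|W vm|^-1 *: W vm); split; [exact: n1|exact: n1|].
move=> z; rewrite !dot_sqrZ ue ve !mulr1 !exprVn.
have [->|z0] := eqVneq z 0; first by rewrite normr0 expr0n/= !mulr0 linear0l lexx.
have ez : 0 < e z z by exact: dot_gt0.
pose s := Num.sqrt (e z z).
have s0 : 0 < s by rewrite sqrtr_gt0.
have sE : s ^+ 2 = e z z by rewrite sqr_sqrtr// ltW.
have normE : `|W (V (s^-1 *: z))| = `|z| / s.
  by rewrite VK normrZ normfV gtr0_norm// mulrC.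
have zA : V (s^-1 *: z) \in A by rewrite inE; exact: AW.
have := umP _ zA; have := vmP _ zA; rewrite normE.
rewrite ler_pdivlMr// ler_pdivrMr// => hv hu.
rewrite ler_pdivrMl ?exprn_gt0// ler_pdivlMl ?exprn_gt0// -sE -!exprMn.
by rewrite !lerXn2r ?nnegrE ?mulr_ge0// ltW.
Qed.

(** A functional is bounded by its Riesz vector, Cauchy-Schwarz and the comparison of [e] with the
    norm. Applied to the coordinates, this bounds any linear map expanded in a basis. *)
Lemma linear_is_bounded_linear (R : realType) (X Y : normedModType R)
    (f : X -> Y) : finite_dimensional X -> linear f -> is_bounded_linear f.
Proof.
move=> fd lf; split=> //.
have f0 : f 0 = 0.
  by have := lf 1 0 0; rewrite !scale1r addr0 -[LHS]addr0 => /addrI.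
have [[x x1]|noS] := pselect (exists x : X, `|x| = 1); last first.
  exists 0 => x; have [->|x0] := eqVneq x 0; first by rewrite f0 !normr0 mulr0.
  case: noS; exists (`|x|^-1 *: x).
  by rewrite normrZ normfV normr_id mulVf// normr_eq0.
have [e [riesz ext]] := euclidean_extremals fd.
have [u [v [_ _ ev]]] := ext x x1.
have bounded_functional (g : X -> R^o) : linear g ->
    exists M, forall z, `|g z| <= M * `|z|.
  move=> lg; have [p gp] := riesz g lg.
  exists (Num.sqrt (e p p * e v v)) => z.
  rewrite -(@ler_pXn2r _ 2)// ?nnegrE ?mulr_ge0 ?sqrtr_ge0//.
  rewrite exprMn sqr_sqrtr ?mulr_ge0 ?dot_ge0// real_normK ?num_real// gp.
  rewrite (le_trans (dot_CauchySchwarz _ _ _))// -mulrA ler_wpM2l ?dot_ge0//.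
  by have /andP[] := ev z.
have [n [V [W [lV lW VK WK]]]] := finite_dimensional_coords fd.
have /choice[M MP] : forall i, exists M, forall z : X, `|V z 0 i| <= M * `|z|.
  move=> i; apply: (bounded_functional (fun z => V z 0 i)) => a y z.
  by rewrite lV !mxE.
exists (\sum_i M i * `|f (W (delta_mx 0 i))|) => z.
rewrite -[in leLHS](VK z) (row_sum_delta (V z)).
rewrite (linear_sum_scale _ _ lW) (linear_sum_scale _ _ lf).
rewrite (le_trans (ler_norm_sum _ _ _))// mulr_suml ler_sum// => i _.
by rewrite normrZ mulrAC ler_wpM2r.
Qed.

Lemma finite_dimensional_dual (R : realType) (X : normedModType R) :
  finite_dimensional X -> finite_dimensional (dual X).
Proof.
move=> fd; have [n [V [W [lV lW VK WK]]]] := finite_dimensional_coords fd.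
have lfun (r : 'rV[R]_n) :
    linear ((fun z => \sum_i V z 0 i *: (r 0 i : R^o)) : X -> R^o).
  move=> a y z; rewrite scaler_sumr -big_split; apply: eq_bigr => i _.
  by rewrite lV !mxE scalerDl scalerA.
have bfun r := linear_is_bounded_linear fd (lfun r).
pose G (r : 'rV[R]_n) : dual X := BoundedOp (introT (bounded_linearP _) (bfun r)).
exists n; constructor.
exists (fun f : dual X => \row_i (f (W (delta_mx 0 i)) : R)).
  by move=> a f g; apply/rowP => i; rewrite !mxE.
exists G => [f|r].
  apply/val_inj/funext => z /=.
  rewrite -[in RHS](VK z) [in RHS](row_sum_delta (V z)).
  rewrite (linear_sum_scale _ _ lW).
  rewrite (linear_sum_scale _ _ (@bounded_op_linear _ _ _ f)).
  by apply: eq_bigr => i _; rewrite mxE.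
apply/rowP => i; rewrite mxE /=.
have VWe j : V (W (delta_mx 0 i)) 0 j = (i == j)%:R.
  by rewrite WK mxE eqxx/= eq_sym.
rewrite (bigD1 i)//= VWe eqxx scale1r big1 ?addr0// => j ji.
by rewrite VWe eq_sym (negbTE ji) scale0r.
Qed.

(** Flattening the norm along [x] forces [q (- x) <= - |x|], and flattening along a basis makes [q]
    linear; both persist in the smaller functional. *)
Lemma norming_functional (R : realType) (X : normedModType R) (x : X) :
  finite_dimensional X -> exists f : dual X,
    (forall z, `|f z : R^o| <= `|z|) /\ f x = `|x|.
Proof.
move=> fd; have [n [V [W [lV lW VK WK]]]] := finite_dimensional_coords fd.
have sN : sublinear (fun z : X => `|z|).
  split=> [y z|t z t0]; first exact: ler_normD.
  by rewrite normrZ ger0_norm.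
have [p [sp pN px]] := sublinear_flatten x sN.
have [q [sq qp qb]] :=
  sublinear_flatten_seq [seq W (delta_mx 0 i) | i <- enum 'I_n] sp.
have lq : linear (q : X -> R^o).
  apply: (@sublinear_span_linear _ _ n q (fun i => W (delta_mx 0 i))
            (fun i z => V z 0 i)) => // [z|i].
    by rewrite -[LHS](VK z) [in LHS](row_sum_delta (V z)) linear_sum_scale.
  by apply: qb; apply/map_f; rewrite mem_enum.
have bq := linear_is_bounded_linear fd lq.
pose f : dual X := BoundedOp (introT (bounded_linearP _) bq).
have fN z : f (- z) = - f z by rewrite -scaleN1r bounded_opZ scaleN1r.
have fle z : f z <= `|z| by rewrite (le_trans (qp z)).
exists f; split=> [z|].
  by rewrite ler_norml fle andbT lerNl -fN -normrN fle.
apply/eqP; rewrite eq_le fle/= -lerN2 -fN.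
exact: le_trans (qp _) px.
Qed.

(** * Moduli and duality *)

Lemma norm_normalize (R : realType) (X : normedModType R) (x : X) :
  x != 0 -> `|(`|x|^-1 *: x : X)| = 1.
Proof. by move=> x0; rewrite normrZ normfV normr_id mulVf// normr_eq0. Qed.

(** The modulus is used at [eps = |x - y|]; for [x = y], outside its range, the triangle inequality
    suffices. *)
Lemma convexity_power_type2P (R : realType) (X : normedModType R) :
  convexity_power_type2 X <-> exists2 c : R, 0 < c &
    forall x y : X, `|x| <= 1 -> `|y| <= 1 ->
      `|x + y| <= 2 - 2 * c * `|x - y| ^+ 2.
Proof.
have half (x y : X) : `|2^-1 *: (x + y)| = `|x + y| / 2.
  by rewrite normrZ gtr0_norm ?invr_gt0// mulrC.
split=> -[c c0 cP]; exists c => //.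
  have le2 (x y : X) : `|x| <= 1 -> `|y| <= 1 -> `|x + y| <= 2.
    by move=> x1 y1; rewrite (le_trans (ler_normD _ _))//; lra.
  move=> x y x1 y1; have [xy0|xy0] := eqVneq `|x - y| 0.
    by rewrite xy0 expr0n/= mulr0 subr0 le2.
  have xy2 : 0 < `|x - y| <= 2.
    by rewrite lt_def xy0 normr_ge0/= le2// normrN.
  have /ereal_infP /(_ (1 - `|2^-1 *: (x + y)|)%:E) := cP _ xy2.
  rewrite lee_fin half => H.
  suff : c * `|x - y| ^+ 2 <= 1 - `|x + y| / 2 by lra.
  by apply: H; exists x, y; rewrite half.
move=> eps /andP[eps0 _]; apply/ereal_infP => _ [x [y [exy x1 y1 ->]]].
rewrite lee_fin half; have := cP x y x1 y1.
have : c * eps ^+ 2 <= c * `|x - y| ^+ 2.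
  by rewrite ler_pM2l// lerXn2r ?nnegrE// ltW.
by lra.
Qed.

(* By convexity, x = t x' with |x'| = 1 is as good as x' itself. *)
Lemma symmetric_sum_le_sphere (R : realType) (X : normedModType R) (M : R)
    (w : X) : (forall x : X, `|x| = 1 -> `|x + w| + `|x - w| <= M) ->
  forall x : X, 0 < `|x| <= 1 -> `|x + w| + `|x - w| <= M.
Proof.
move=> H x /andP[x0 x1]; set t := `|x| in x0 x1.
pose y := t^-1 *: x.
have ty : x = t *: y by rewrite scalerA divff ?scale1r// gt_eqF.
have /H yM : `|y| = 1 by rewrite norm_normalize// -normr_gt0.
clearbody y.
(* A convex combination of [y + v] and [v - y]; the bounds for [v = w] and [v = - w] add up to the
   claim. *)
have comb (v : X) : x + v = ((1 + t) / 2) *: (y + v) - ((1 - t) / 2) *: (y - v).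
  rewrite scalerDr scalerBr opprD opprK addrACA -scalerBl -scalerDl ty.
  have -> : (1 + t) / 2 - (1 - t) / 2 = t by field.
  have -> : (1 + t) / 2 + (1 - t) / 2 = 1 by field.
  by rewrite scale1r.
have le v : `|x + v| <= (1 + t) / 2 * `|y + v| + (1 - t) / 2 * `|y - v|.
  rewrite comb (le_trans (ler_normB _ _))//.
  have t1 : 0 <= (1 - t) / 2 by lra.
  have t2 : 0 <= (1 + t) / 2 by lra.
  by rewrite (normrZ _ (y + v)) (normrZ _ (y - v)) (ger0_norm t1) (ger0_norm t2).
by have := le w; have := le (- w); rewrite opprK; lra.
Qed.

Lemma smoothness_power_type2P (R : realType) (X : normedModType R) :
  smoothness_power_type2 X <-> exists2 C : R, 0 < C &
    forall x w : X, `|x| <= 1 ->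
      `|x + w| + `|x - w| <= 2 + 2 * C * `|w| ^+ 2.
Proof.
split=> [[C0 CP]|[C C0 CP]]; last first.
  exists C => tau tau0; apply/ereal_supP => _ [x [y [x1 y1 ->]]].
  have := CP x (tau *: y); rewrite x1 lexx normrZ y1 mulr1 gtr0_norm//.
  by rewrite lee_fin => /(_ isT); lra.
have C0C : C0 <= `|C0| + 1 by have := ler_norm C0; lra.
(* The summand 1 makes the constant positive and settles [x = 0], where [2 |w| <= 1 + |w|^2]. *)
exists (`|C0| + 1); first by rewrite ltr_wpDl.
move=> x w x1; have [->|x0] := eqVneq x 0.
  rewrite add0r sub0r normrN.
  have : 0 <= (`|w| - 1) ^+ 2 by exact: sqr_ge0.
  have : 0 <= `|C0| * `|w| ^+ 2 by rewrite mulr_ge0 ?sqr_ge0.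
  by have := sqr_ge0 `|w|; lra.
apply: symmetric_sum_le_sphere; last by rewrite normr_gt0 x0.
move=> {x0 x1}x x1; have [->|w0] := eqVneq w 0.
  by rewrite subr0 addr0 normr0 x1; lra.
have nw0 : 0 < `|w| by rewrite normr_gt0.
have /ereal_supP/(_ (2^-1 * (`|x + w| + `|x - w|) - 1)%:E) := CP _ nw0.
rewrite lee_fin => H.
have {}H : 2^-1 * (`|x + w| + `|x - w|) - 1 <= C0 * `|w| ^+ 2.
  apply: H; exists x, (`|w|^-1 *: w).
  by rewrite scalerA divff ?gt_eqF// scale1r norm_normalize.
have : C0 * `|w| ^+ 2 <= (`|C0| + 1) * `|w| ^+ 2 by rewrite ler_wpM2r ?sqr_ge0.
by lra.
Qed.

(** * Duality of convexity and smoothness for a norming pairing, to be read in both directions *)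

Section Duality.
Variables (R : realType) (X Y : normedModType R) (B : X -> Y -> R).
Hypotheses (Bl : forall a x x' y, B (a *: x + x') y = a * B x y + B x' y)
  (Br : forall a x y y', B x (a *: y + y') = a * B x y + B x y')
  (Ble : forall x y, B x y <= `|x| * `|y|)
  (Bnorm : forall y M, (forall x, `|x| <= 1 -> B x y <= M) -> `|y| <= M).

Let norm2_le u v M : (forall x y, `|x| <= 1 -> `|y| <= 1 -> B x u + B y v <= M) ->
  `|u| + `|v| <= M.
Proof.
move=> H; rewrite -lerBrDr; apply: Bnorm => x x1.
rewrite lerBrDr addrC -lerBrDr; apply: Bnorm => y y1.
by rewrite lerBrDr addrC H.
Qed.

Let swap x y f g : B x (f + g) + B y (f - g) = B (x + y) f + B (x - y) g.
Proof.
have BDl u v h : B (u + v) h = B u h + B v h by have := Bl 1 u v h; rewrite scale1r mul1r.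
have BDr u h k : B u (h + k) = B u h + B u k by have := Br 1 u h k; rewrite scale1r mul1r.
have BNl u v h : B (u - v) h = B u h - B v h.
  by rewrite addrC -scaleN1r Bl; ring.
have BNr u h k : B u (h - k) = B u h - B u k.
  by rewrite addrC -scaleN1r Br; ring.
by rewrite BDl BDr BNl BNr; ring.
Qed.

Let BZ t x y : B x (t *: y) = B (t *: x) y.
Proof.
have B0r u : B u 0 = 0 by have := Br 1 u 0 0; rewrite scale1r addr0 mul1r; lra.
have B0l h : B 0 h = 0 by have := Bl 1 0 0 h; rewrite scale1r addr0 mul1r; lra.
by have := Br t x y 0; have := Bl t x 0 y; rewrite !addr0 B0r B0l => -> ->.
Qed.

(** Testing [f + g] on [x] and [t (f - g)] on [y] gives [B (x + t y) f + B (x - t y) g], which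
    smoothness of [X] bounds. *)
Lemma smoothness_convexity_dual :
  smoothness_power_type2 X -> convexity_power_type2 Y.
Proof.
move=> /smoothness_power_type2P[C C0 CP]; apply/convexity_power_type2P.
exists (16 * C)^-1; first by rewrite invr_gt0 mulr_gt0.
move=> f g f1 g1; set d := `|f - g|.
(* This [t] maximizes [t d - 2 C t^2]; the maximum [d^2 / (8 C)] yields the constant
   [1 / (16 C)]. *)
pose t := d / (4 * C).
have t0 : 0 <= t by rewrite divr_ge0 ?mulr_ge0 ?(ltW C0) ?normr_ge0.
have : `|f + g| + `|t *: (f - g)| <= 2 + 2 * C * t ^+ 2.
  apply: norm2_le => x y x1 y1.
  rewrite BZ swap; set z := t *: y.
  have zt : `|z| <= t by rewrite normrZ ger0_norm// ler_piMr.
  have h (v : X) (h : Y) : `|h| <= 1 -> B v h <= `|v|.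
    by move=> h1; rewrite (le_trans (Ble _ _))// ler_piMr.
  have := CP x z x1; have := h (x + z) f f1; have := h (x - z) g g1.
  have : 2 * C * `|z| ^+ 2 <= 2 * C * t ^+ 2.
    by rewrite ler_pM2l ?mulr_gt0// lerXn2r ?nnegrE.
  by lra.
rewrite normrZ ger0_norm// -/d.
have -> : 2 * C * t ^+ 2 = d ^+ 2 / (8 * C) by rewrite /t; field; rewrite gt_eqF.
have -> : t * d = d ^+ 2 / (4 * C) by rewrite /t; field; rewrite gt_eqF.
have -> : d ^+ 2 / (4 * C) = 2 * (d ^+ 2 / (8 * C)) by field; rewrite gt_eqF.
have -> : 2 * (16 * C)^-1 * d ^+ 2 = d ^+ 2 / (8 * C) by field; rewrite gt_eqF.
by lra.
Qed.

Lemma convexity_smoothness_dual :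
  convexity_power_type2 X -> smoothness_power_type2 Y.
Proof.
move=> /convexity_power_type2P[c c0 cP]; apply/smoothness_power_type2P.
exists (16 * c)^-1; first by rewrite invr_gt0 mulr_gt0.
move=> f g f1; apply: norm2_le => x y x1 y1; rewrite swap.
set d := `|x - y|; set t := `|g|.
have Bf : B (x + y) f <= `|x + y|.
  by rewrite (le_trans (Ble _ _))// ler_piMr.
have Bg : B (x - y) g <= d * t by exact: Ble.
(* Completing the square bounds [d t - 2 c d^2] by [t^2 / (8 c)]. *)
have : 0 <= (4 * c * d - t) ^+ 2 / (8 * c).
  by rewrite divr_ge0 ?sqr_ge0// mulr_ge0// ltW.
have -> : (4 * c * d - t) ^+ 2 / (8 * c) =
    2 * c * d ^+ 2 - d * t + 2 * (16 * c)^-1 * t ^+ 2.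
  by field; rewrite gt_eqF.
by have := cP x y x1 y1; rewrite -/d; lra.
Qed.

End Duality.

Lemma dual_power_type2 (R : realType) (X : normedModType R) :
  convexity_power_type2 X /\ smoothness_power_type2 X ->
  convexity_power_type2 (dual X) /\ smoothness_power_type2 (dual X).
Proof.
pose B (x : X) (f : dual X) : R := f x.
have Bl a x x' y : B (a *: x + x') y = a * B x y + B x' y.
  exact: bounded_op_linear.
have Br a x y y' : B x (a *: y + y') = a * B x y + B x y' by [].
have Ble x y : B x y <= `|x| * `|y|.
  by rewrite mulrC (le_trans (ler_norm _))//; exact: op_normP.
have Bnorm y M : (forall x, `|x| <= 1 -> B x y <= M) -> `|y| <= M.
  move=> H; apply: op_norm_le => x x1; rewrite ler_norml lerNl.
  rewrite -scaleN1r -bounded_opZ scaleN1r.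
  by apply/andP; split; apply: H; rewrite ?normrN.
case=> cX sX; split.
  exact: smoothness_convexity_dual Bl Br Ble Bnorm sX.
exact: convexity_smoothness_dual Bl Br Ble Bnorm cX.
Qed.

(** The evaluation pairing with its sides exchanged; that it norms the vectors of [X] is the
    existence of norming functionals. *)
Lemma predual_power_type2 (R : realType) (X : normedModType R) :
  finite_dimensional X ->
  convexity_power_type2 (dual X) /\ smoothness_power_type2 (dual X) ->
  convexity_power_type2 X /\ smoothness_power_type2 X.
Proof.
move=> fd; pose B (f : dual X) (x : X) : R := f x.
have Bl a f f' y : B (a *: f + f') y = a * B f y + B f' y by [].
have Br a f y y' : B f (a *: y + y') = a * B f y + B f y'.
  exact: bounded_op_linear.
have Ble f y : B f y <= `|f| * `|y|.
  by rewrite (le_trans (ler_norm _))//; exact: op_normP.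
have Bnorm y M : (forall f, `|f| <= 1 -> B f y <= M) -> `|y| <= M.
  move=> H; have [f [f1 <-]] := norming_functional y fd.
  apply: H; apply: op_norm_le => z z1; exact: le_trans (f1 z) z1.
case=> cX sX; split.
  exact: smoothness_convexity_dual Bl Br Ble Bnorm sX.
exact: convexity_smoothness_dual Bl Br Ble Bnorm cX.
Qed.

(** * Ellipsoids *)

(** Scaling [z] to [p1 z = 1] turns an inclusion of balls into an inequality of norms. *)
Lemma homogeneous_le (R : realType) (X : lmodType R) (p1 p2 : X -> R) (k : R) :
  (forall a z, p1 (a *: z) = `|a| * p1 z) ->
  (forall a z, p2 (a *: z) = `|a| * p2 z) ->
  (forall z, z != 0 -> 0 < p1 z) ->
  (forall z, p1 z <= 1 -> p2 z <= k) -> forall z, p2 z <= k * p1 z.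
Proof.
move=> h1 h2 p1_gt0 H z; have [->|z0] := eqVneq z 0.
  have := h1 0 0; have := h2 0 0.
  by rewrite scale0r normr0 !mul0r => -> ->; rewrite mulr0.
have pz := p1_gt0 _ z0; have iz : 0 < (p1 z)^-1 by rewrite invr_gt0.
have := H ((p1 z)^-1 *: z).
rewrite h1 h2 gtr0_norm// mulVf ?gt_eqF// => /(_ (lexx _)).
by rewrite mulrC ler_pdivrMr.
Qed.

(** * Ellipsoids at a point as inequalities between quadratic forms *)

Section InnerOuterForms.
Variables (R : realType) (X : normedModType R).
Implicit Types (x z : X) (q : {dot X for (idfun : R -> R)}).

Let ball_of q : set X := [set z | Num.sqrt (q z z) <= 1].

Let ball_ofE q z : ball_of q z <-> q z z <= 1.
Proof. by rewrite /ball_of/= -{1}sqrtr1 ler_sqrt. Qed.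

Let sqrtZ q a z : Num.sqrt (q (a *: z) (a *: z)) = `|a| * Num.sqrt (q z z).
Proof. by rewrite dot_sqrZ sqrtrM ?sqr_ge0// sqrtr_sqr. Qed.

Let sqrt_gt0 q z : z != 0 -> 0 < Num.sqrt (q z z).
Proof. by move=> z0; rewrite sqrtr_gt0 dot_gt0. Qed.

Let sqr_le (a b : R) : 0 <= a -> a <= b -> a ^+ 2 <= b ^+ 2.
Proof. by move=> a0 ab; rewrite lerXn2r ?nnegrE// (le_trans a0). Qed.

Lemma interior_dot_ball q x : (forall z, q z z <= `|z| ^+ 2) -> q x x < 1 ->
  nbhs x [set z | Num.sqrt (q z z) <= 1].
Proof.
move=> qle qx; apply/nbhs_ballP.
(* For [h = z - x] both [q h h] and [q x h] will be at most [d], so [q z z <= q x x + 3 d = 1]. *)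
pose d := (1 - q x x) / 3.
have d0 : 0 < d by rewrite divr_gt0// subr_gt0.
have d1 : d <= 1 by have := dot_ge0 q x; rewrite /d; lra.
exists d => // z; rewrite -ball_normE/= => /ltW xz; apply/ball_ofE.
set h := z - x; have hd : `|h| <= d by rewrite /h distrC.
have -> : z = x + h by rewrite addrC subrK.
rewrite dot_sqrD.
have qh : q h h <= d.
  rewrite (le_trans (qle _))// (le_trans (sqr_le (normr_ge0 _) hd))//.
  by rewrite expr2 ler_piMl// ltW.
have qxh : q x h <= d.
  rewrite (le_trans (ler_norm _))// -(@ler_pXn2r _ 2)// ?nnegrE ?(ltW d0)//.
  rewrite real_normK ?num_real// (le_trans (dot_CauchySchwarz _ _ _))//.
  rewrite (@le_trans _ _ (1 * `|h| ^+ 2))//.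
    by rewrite ler_pM ?dot_ge0// ltW.
  by rewrite mul1r sqr_le.
by rewrite /d in qh qxh; lra.
Qed.

Lemma inner_outer_forms (lambda : R) x : `|x| = 1 ->
  (exists E F : set X, [/\ inner_ellipsoid x E, outer_ellipsoid x F &
      F `<=` [set lambda *: y | y in E]]) ->
  exists qE qF : {dot X for (idfun : R -> R)},
    [/\ forall z, `|z| ^+ 2 <= qE z z, qE x x <= 1,
        forall z, qF z z <= `|z| ^+ 2, 1 <= qF x x &
        forall z, qE z z <= lambda ^+ 2 * qF z z].
Proof.
move=> x1 [_ [_ [[[qE ->] EB Ex] [[qF ->] BF Fx] FE]]]; exists qE, qF.
have qF_le z : qF z z <= `|z| ^+ 2.
  have := @homogeneous_le _ _ (fun z => `|z|) (fun z => Num.sqrt (qF z z)) 1.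
  move=> /(_ (@normrZ _ _) (sqrtZ qF)) H.
  rewrite -[leLHS]sqr_sqrtr ?dot_ge0// sqr_le ?sqrtr_ge0//.
  rewrite -[leRHS]mul1r; apply: H => {}z; first by rewrite normr_gt0.
  exact: BF.
split=> //.
- move=> z.
  have := @homogeneous_le _ _ (fun z => Num.sqrt (qE z z)) (fun z => `|z|) 1.
  move=> /(_ (sqrtZ qE) (@normrZ _ _) (sqrt_gt0 qE) EB z); rewrite mul1r => H.
  by rewrite -[leRHS]sqr_sqrtr ?dot_ge0// sqr_le.
- exact/ball_ofE.
- rewrite leNgt; apply/negP => qx1; case: Fx => _; apply.
  exact: interior_dot_ball.
- move=> z.
  have := @homogeneous_le _ _ (fun z => Num.sqrt (qF z z))
    (* The sign of [lambda] is arbitrary, so its absolute value serves as the factor. *)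
    (fun z => Num.sqrt (qE z z)) `|lambda|.
  move=> /(_ (sqrtZ qF) (sqrtZ qE) (sqrt_gt0 qF)) H.
  rewrite -[leLHS]sqr_sqrtr ?dot_ge0// -[q in _ * q]sqr_sqrtr ?dot_ge0//.
  rewrite -[lambda ^+ 2]real_normK ?num_real// -exprMn sqr_le ?sqrtr_ge0// H//.
  by move=> {}z /FE[y Ey <-]; rewrite sqrtZ ler_piMr.
Qed.

Lemma forms_inner_outer (lambda : R) x (qE qF : {dot X for (idfun : R -> R)}) :
  0 < lambda -> `|x| = 1 ->
  (forall z, `|z| ^+ 2 <= qE z z) -> qE x x <= 1 ->
  (forall z, qF z z <= `|z| ^+ 2) -> 1 <= qF x x ->
  (forall z, qE z z <= lambda ^+ 2 * qF z z) ->
  exists E F : set X, [/\ inner_ellipsoid x E, outer_ellipsoid x F &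
      F `<=` [set lambda *: y | y in E]].
Proof.
move=> l0 x1 Ele Ex Fle Fx EF; exists (ball_of qE), (ball_of qF); split.
- split; [by exists qE| |exact/ball_ofE].
  move=> z /ball_ofE qz /=.
  rewrite -(@ler_pXn2r _ 2)// ?nnegrE// expr1n.
  exact: le_trans (Ele z) qz.
- split; first by exists qF.
    move=> z /= z1; apply/ball_ofE; rewrite (le_trans (Fle z))//.
    by rewrite expr_le1.
  split.
    by apply/subset_closure/ball_ofE; rewrite (le_trans (Fle x))// x1 expr1n.
  move=> /nbhs_ballP[d /= d0 dF].
  have d20 : 0 < d / 2 by rewrite divr_gt0.
  (* Points slightly beyond [x] on its ray lie outside the outer ellipsoid, so [x] is not
     interior. *)
  have /dF/ball_ofE : ball x d ((1 + d / 2) *: x).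
    rewrite -ball_normE/= scalerDl scale1r opprD addNKr normrN normrZ x1 mulr1.
    by rewrite gtr0_norm// ltr_pdivrMr//; lra.
  rewrite dot_sqrZ => H.
  have : (1 + d / 2) ^+ 2 * 1 <= 1.
    by apply: le_trans H; rewrite ler_wpM2l ?sqr_ge0.
  by rewrite mulr1; nra.
- move=> z /ball_ofE Fz; exists (lambda^-1 *: z).
    apply/ball_ofE; rewrite dot_sqrZ exprVn ler_pdivrMl ?exprn_gt0// mulr1.
    by rewrite (le_trans (EF z))// ler_piMr ?sqr_ge0.
  by rewrite scalerA divff ?scale1r// gt_eqF.
Qed.

End InnerOuterForms.

(** * Condition (c): its consequence (d) and its derivation from (a) *)

Definition uniform_ellipsoids (R : realType) (X : normedModType R) : Prop :=
  exists lambda : R, forall x : X, unit_sphere X x ->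
    exists E F : set X,
      [/\ inner_ellipsoid x E, outer_ellipsoid x F &
          F `<=` [set lambda *: y | y in E]].

Lemma uniform_ellipsoids_power_type2 (R : realType) (X : normedModType R) :
  uniform_ellipsoids X -> convexity_power_type2 X /\ smoothness_power_type2 X.
Proof.
move=> [lambda H]; pose L := lambda ^+ 2 + 1.
have L1 : 1 <= L by rewrite lerDr sqr_ge0.
have L0 : 0 < L by exact: lt_le_trans L1.
have {}H (x : X) : `|x| = 1 -> exists qE qF : {dot X for (idfun : R -> R)},
    [/\ forall z, `|z| ^+ 2 <= qE z z, qE x x <= 1,
        forall z, qF z z <= `|z| ^+ 2, 1 <= qF x x &
        forall z, qE z z <= L * qF z z].
  move=> x1; have [qE [qF [? ? ? ? EF]]] := inner_outer_forms x1 (H x x1).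
  exists qE, qF; split=> // z; rewrite (le_trans (EF z))// ler_wpM2r ?dot_ge0//.
  by rewrite lerDl.
split.
  apply/convexity_power_type2P; exists (8 * L)^-1.
    by rewrite invr_gt0 mulr_gt0.
  move=> a b a1 b1; set s := `|a - b| ^+ 2 / (4 * L).
  have -> : 2 * (8 * L)^-1 * `|a - b| ^+ 2 = s.
    by rewrite /s; field; rewrite gt_eqF.
  have [->|m0] := eqVneq (a + b) 0.
    rewrite normr0 subr_ge0 ler_pdivrMr ?mulr_gt0//.
    have ab2 : `|a - b| <= 2 by rewrite (le_trans (ler_normB _ _))//; lra.
    have : `|a - b| ^+ 2 <= 2 ^+ 2 by rewrite lerXn2r ?nnegrE.
    by lra.
  have nm : 0 < `|a + b| by rewrite normr_gt0.
  have [qE [qF [Ele _ Fle Fx EF]]] := H _ (norm_normalize m0).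
  move: Fx; rewrite dot_sqrZ exprVn ler_pdivlMl ?exprn_gt0// mulr1 => mF.
  have := dot_parallelogram qF a b.
  have sqr1 (z : X) : `|z| <= 1 -> qF z z <= 1.
    by move=> z1; rewrite (le_trans (Fle z))// expr_le1.
  have := sqr1 a a1; have := sqr1 b b1.
  have sF : 4 * s <= qF (a - b) (a - b).
    have -> : 4 * s = `|a - b| ^+ 2 / L by rewrite /s; field; rewrite gt_eqF.
    by rewrite ler_pdivrMr// mulrC (le_trans (Ele _)).
  have ab2 : `|a + b| <= 2 by rewrite (le_trans (ler_normD _ _))//; lra.
  (* The parallelogram law gives [m^2 + 4 s <= 4] for [m = |a + b|]; since [m^2 >= 4 m - 4], this
     becomes [m <= 2 - s]. *)
  have : 0 <= (2 - `|a + b|) ^+ 2 by exact: sqr_ge0.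
  by move: sF mF; move: (qF _ _) (qF _ _) (qF a a) (qF b b) => ? ? ? ?; lra.
exists L => tau tau0; apply/ereal_supP => _ [x [y [x1 y1 ->]]].
rewrite lee_fin.
have [qE [qF [Ele Ex Fle Fx EF]]] := H x x1.
have Ey : qE y y <= L.
  rewrite (le_trans (EF y))// ler_piMr ?(ltW L0)//.
  by rewrite (le_trans (Fle y))// y1 expr1n.
have := dot_parallelogram qE x (tau *: y).
rewrite (dot_sqrZ qE tau y).
have : tau ^+ 2 * qE y y <= L * tau ^+ 2 by rewrite mulrC ler_wpM2r ?sqr_ge0.
have : 0 <= L * tau ^+ 2 by rewrite mulr_ge0 ?sqr_ge0// ltW.
have := Ele (x + tau *: y); have := Ele (x - tau *: y).
move: (`|x + _|) (`|x - _|) (qE (x + _) _) (qE (x - _) _) => s t qs qt qt_ge qs_ge.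
move: (tau ^+ 2 * _) (L * _) => v w w0 vw qst.
(* From [s^2 + t^2 <= 2 + 2 w] follows [4 (s + t) <= (s + t)^2 + 4 <= 8 + 4 w], so
   [(s + t) / 2 - 1 <= w / 2]. *)
by have := sqr_ge0 (s - t); have := sqr_ge0 (s + t - 2); lra.
Qed.

Lemma semitransitive_uniform_ellipsoids (R : realType) (X : normedModType R) :
  finite_dimensional X -> boundedly_semitransitive X -> uniform_ellipsoids X.
Proof.
move=> fd [K HK].
have [[x0 x01]|noS] := pselect (exists x : X, `|x| = 1); last first.
  by exists 0 => x x1; case: noS; exists x.
have [e [_ ext]] := euclidean_extremals fd.
have [u [v [u1 v1 ev]]] := ext x0 x01.
have S0 (z : X) : `|z| = 1 -> 0 < e z z.
  by move=> z1; rewrite dot_gt0// -normr_gt0 z1.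
have eu := S0 u u1; have evv := S0 v v1.
pose k := e v v / e u u.
have k0 : 0 < k by rewrite divr_gt0.
pose L := `|K| + 1.
have L0 : 0 < L by rewrite ltr_wpDl.
(* Each of the two comparisons of [e] with the norm costs a factor [k], each of the two inverse
   operators a factor [L^2]; the product is the square of this constant. *)
exists (k * L ^+ 2) => x x1; rewrite /unit_sphere/= in x1.
have unitary (y z : X) : `|y| = 1 -> `|z| = 1 -> exists T U : bounded_op X X,
    [/\ cancel T U, cancel U T, z = T y, forall w, `|T w| <= `|w| &
        forall w, `|U w| <= L * `|w|].
  move=> y1 z1; have [T [[_ T1] Ty [U [TU UT] UK]]] := HK y z y1 z1.
  exists T, U; split=> // w.
    by rewrite (le_trans (op_normP T w))// ler_piMl.
  rewrite (le_trans (op_normP U w))// ler_wpM2r// (le_trans UK)//.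
  by rewrite (le_trans (ler_norm K))// lerDl.
have [T [U [TU UT Tu Tle Ule]]] := unitary u x u1 x1.
have [S [V [SV VS Sx Sle Vle]]] := unitary x v x1 v1.
have pull c (A B : bounded_op X X) : 0 < c -> cancel A B ->
    exists q : {dot X for (idfun : R -> R)}, forall z, q z z = e (A z) (A z) / c.
  move=> c0 AB; pose s := (Num.sqrt c)^-1.
  have s0 : s != 0 by rewrite invr_neq0// gt_eqF// sqrtr_gt0.
  have lA : linear (fun z => s *: A z).
    by move=> a y z; rewrite bounded_op_linear scalerDr !scalerA mulrC.
  have iA : injective (fun z => s *: A z).
    by move=> y z /(scalerI s0)/(can_inj AB).
  have [q qE] := dot_pullback e lA iA; exists q => z.
  by rewrite qE dot_sqrZ exprVn sqr_sqrtr ?(ltW c0)// mulrC.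
(* [qE] defines the image under [T] of the inner ellipsoid at [u], and [qF] the preimage under [S]
   of the outer ellipsoid at [v]. *)
have [qE qEE] := pull _ _ _ eu UT.
have [qF qFE] := pull _ _ _ evv SV.
have sqr_le (a b : R) : 0 <= a -> a <= b -> a ^+ 2 <= b ^+ 2.
  by move=> a0 ab; rewrite lerXn2r ?nnegrE// (le_trans a0).
apply: (@forms_inner_outer _ _ _ _ qE qF) => //.
- by rewrite mulr_gt0// exprn_gt0.
- move=> z; rewrite qEE ler_pdivlMr// mulrC.
  have /andP[+ _] := ev (U z); apply: le_trans.
  by rewrite ler_pM2l// sqr_le// -{1}(UT z).
- by rewrite qEE Tu TU divff// gt_eqF.
- move=> z; rewrite qFE ler_pdivrMr// mulrC.
  have /andP[_ h] := ev (S z); apply: (le_trans h).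
  by rewrite ler_pM2l// sqr_le.
- by rewrite qFE -Sx divff// gt_eqF.
- move=> z.
  have EU : qE z z <= k * `|U z| ^+ 2.
    rewrite qEE ler_pdivrMr// /k mulrAC divfK ?gt_eqF//.
    by have /andP[] := ev (U z).
  have FS : `|S z| ^+ 2 <= k * qF z z.
    rewrite qFE /k mulrCA mulrA mulrAC mulrA.
    rewrite -mulrA mulrA divfK ?gt_eqF//.
    by rewrite ler_pdivlMr// mulrC; have /andP[] := ev (S z).
  have Uz : `|U z| ^+ 2 <= L ^+ 2 * `|z| ^+ 2 by rewrite -exprMn sqr_le.
  have Sz : `|z| ^+ 2 <= L ^+ 2 * `|S z| ^+ 2.
    by rewrite -exprMn sqr_le// -{1}(SV z).
  rewrite (le_trans EU)//.
  have -> : (k * L ^+ 2) ^+ 2 * qF z z = k * (L ^+ 2 * (L ^+ 2 * (k * qF z z))).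
    by ring.
  rewrite ler_pM2l// (le_trans Uz)// ler_pM2l ?exprn_gt0//.
  by rewrite (le_trans Sz)// ler_pM2l ?exprn_gt0.
Qed.

(** * Semitransitivity from the moduli *)

Section Support.
Variables (R : realType) (X : normedModType R) (x : X) (f : dual X).
Hypotheses (x1 : `|x| = 1) (fx : f x = 1) (fle : forall z, `|f z : R^o| <= `|z|).

Let fB a z : f (z - a *: x) = f z - a.
Proof.
rewrite addrC -scaleNr bounded_op_linear fx.
by rewrite addrC; congr (_ + _); exact: mulr1.
Qed.

Let fZ a z : f (a *: z) = a * f z.
Proof. exact: bounded_opZ. Qed.

(** For [|z| = 1] and [a = f z >= 0], convexity gives [1 + a <= |x + z| <= 2 - 2 c s^2] with
    [s = |x - z|], while [|z - a x| <= s + (1 - a)]. Symmetry and scaling give all other [z]. *)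
Lemma convex_support_lower (c : R) : 0 < c ->
  (forall y z : X, `|y| <= 1 -> `|z| <= 1 ->
    `|y + z| <= 2 - 2 * c * `|y - z| ^+ 2) ->
  forall z, f z ^+ 2 + c / (1 + 2 * c) * `|z - f z *: x| ^+ 2 <= `|z| ^+ 2.
Proof.
move=> c0 cP.
have d0 : 0 < 1 + 2 * c by lra.
have unit_ge0 z : `|z| = 1 -> 0 <= f z ->
    f z ^+ 2 + c / (1 + 2 * c) * `|z - f z *: x| ^+ 2 <= 1.
  move=> z1; set a : R := f z => a0.
  have a1 : a <= 1 by rewrite (le_trans (ler_norm _))// (le_trans (fle z)) ?z1.
  set s := `|x - z|.
  have xz : 1 + a <= 2 - 2 * c * s ^+ 2.
    have <- : f (x + z) = 1 + a.
      by have := bounded_op_linear f 1 x z; rewrite !scale1r fx.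
    apply: le_trans (cP x z _ _); rewrite ?x1 ?z1//.
    exact: le_trans (ler_norm _) (fle _).
  have vs : `|z - a *: x| <= s + (1 - a).
    have -> : z - a *: x = - (x - z) + (1 - a) *: x.
      by rewrite scalerBl scale1r opprB addrA subrK.
    rewrite (le_trans (ler_normD _ _))// normrN normrZ x1 mulr1.
    by rewrite ger0_norm// subr_ge0.
  have vs2 : `|z - a *: x| ^+ 2 <= (s + (1 - a)) ^+ 2.
    by rewrite lerXn2r ?nnegrE ?(le_trans _ vs).
  move: (`|z - a *: x| ^+ 2) vs2 => w vs2.
  rewrite -lerBrDl mulrAC ler_pdivrMr//.
  (* Continuing with [2 c s^2 <= 1 - a] and [(1 - a)^2 <= 1 - a] yields [c w <= (1 + 2 c) (1 - a) <=
     (1 + 2 c) (1 - a^2)]. *)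
  have : c * w <= c * (2 * s ^+ 2 + 2 * (1 - a) ^+ 2).
    rewrite ler_pM2l// (le_trans vs2)//.
    by have := sqr_ge0 (s - (1 - a)); lra.
  have : c * (1 - a) ^+ 2 <= c * (1 - a).
    by rewrite ler_pM2l// expr2 ler_piMl ?subr_ge0//; lra.
  have : 0 <= a * (1 - a) * (1 + 2 * c).
    by rewrite !mulr_ge0 ?subr_ge0// ltW.
  by lra.
move=> z; have [->|z0] := eqVneq z 0.
  have -> : f 0 = 0 :> R by exact: bounded_op0.
  by rewrite scale0r subrr normr0 expr0n/= mulr0 addr0.
have nz : 0 < `|z| by rewrite normr_gt0.
wlog fz0 : z z0 nz / 0 <= f z => [H|].
  have [fz|fz] := leP 0 (f z : R); first exact: H.
  have := H (- z); rewrite oppr_eq0 !normrN -scaleN1r fZ mulN1r => /(_ z0 nz).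
  rewrite oppr_ge0 sqrrN scaleN1r scaleNr -opprD normrN.
  by apply; exact: ltW.
have := unit_ge0 (`|z|^-1 *: z) (norm_normalize z0).
rewrite fZ => /(_ (mulr_ge0 (ltW _) fz0)); rewrite invr_gt0 => /(_ nz).
rewrite -scalerA -scalerBr normrZ normfV normr_id !exprMn exprVn.
move=> h; rewrite -[leRHS]mulr1 -ler_pdivrMl ?exprn_gt0//.
by apply: le_trans h; lra.
Qed.

(** Write [z = a (x + w)] with [f w = 0]. Then [|x - w| >= 1], so smoothness bounds [r = |x + w|] by
    [1 + 2 C |w|^2]; the claim is [r^2 = 1 + 2 (r - 1) + (r - 1)^2] with [0 <= r - 1 <= |w|]. *)
Lemma smooth_support_upper (C : R) : 0 < C ->
  (forall y w : X, `|y| <= 1 -> `|y + w| + `|y - w| <= 2 + 2 * C * `|w| ^+ 2) ->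
  forall z, `|z| ^+ 2 <= f z ^+ 2 + (4 * C + 1) * `|z - f z *: x| ^+ 2.
Proof.
move=> C0 CP z; have [fz|fz] := eqVneq (f z : R) 0.
  rewrite fz scale0r subr0 expr0n/= add0r ler_peMl ?sqr_ge0//.
  by rewrite lerDr mulr_ge0// ltW.
set a : R := f z in fz *; set w := a^-1 *: (z - a *: x).
have zE : z = a *: (x + w).
  by rewrite scalerDr scalerA divff// scale1r addrC subrK.
have fw : f w = 0 by rewrite fZ fB subrr; exact: mulr0.
have fxw t : f (x + t *: w) = 1.
  by rewrite addrC bounded_op_linear fw fx scaler0 add0r.
have r1 : 1 <= `|x + w|.
  have := fxw 1; rewrite scale1r => <-.
  exact: le_trans (ler_norm _) (fle _).
have r1' : 1 <= `|x - w|.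
  have := fxw (-1); rewrite scaleN1r => <-.
  exact: le_trans (ler_norm _) (fle _).
have wE : z - a *: x = a *: w by rewrite scalerA divff// scale1r.
clearbody w.
rewrite wE [in leLHS]zE !normrZ !exprMn real_normK ?num_real//.
have -> : a ^+ 2 + (4 * C + 1) * (a ^+ 2 * `|w| ^+ 2) =
    a ^+ 2 * (1 + (4 * C + 1) * `|w| ^+ 2) by ring.
rewrite ler_wpM2l ?sqr_ge0//.
have := CP x w; rewrite x1 lexx => /(_ isT) h.
have tr : `|x + w| <= 1 + `|w| by rewrite (le_trans (ler_normD _ _))// x1.
have : (`|x + w| - 1) ^+ 2 <= `|w| ^+ 2.
  by rewrite lerXn2r ?nnegrE ?subr_ge0//; lra.
by lra.
Qed.
End Support.

(** The reflection exchanging the normalized [p] and [q] also exchanges their orthogonal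
    complements. *)
Lemma kernel_isometry (R : realType) (X : lmodType R)
    (e : {dot X for (idfun : R -> R)}) p q : p != 0 -> q != 0 ->
  exists H : X -> X, [/\ linear H, involutive H,
    forall z, e (H z) (H z) = e z z,
    forall z, e p z = 0 -> e q (H z) = 0 &
    forall z, e q z = 0 -> e p (H z) = 0].
Proof.
move=> p0 q0; have ep := dot_gt0 e p0; have eq := dot_gt0 e q0.
pose n z := (Num.sqrt (e z z))^-1.
have n1 z : 0 < e z z -> e (n z *: z) (n z *: z) = 1.
  move=> ez; rewrite dot_sqrZ exprVn sqr_sqrtr ?(ltW ez)// mulVf// gt_eqF//.
have n0 z : 0 < e z z -> n z != 0 by move=> ez; rewrite invr_neq0// gt_eqF ?sqrtr_gt0.
have [H [lH HK He Hpq]] : exists H : X -> X, [/\ linear H, involutive H,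
    forall z, e (H z) (H z) = e z z & forall z, e (n q *: q) (H z) = e (n p *: p) z].
  by apply: dot_reflection; rewrite !n1.
exists H; split=> // z ez.
  by apply: (mulfI (n0 q eq)); rewrite -dotZl Hpq dotZl ez !mulr0.
by apply: (mulfI (n0 p ep)); rewrite -dotZl -Hpq HK dotZl ez !mulr0.
Qed.

Lemma power_type2_semitransitive (R : realType) (X : normedModType R) :
  finite_dimensional X ->
  convexity_power_type2 X /\ smoothness_power_type2 X ->
  boundedly_semitransitive X.
Proof.
move=> fd [/convexity_power_type2P[c c0 cP] /smoothness_power_type2P[C C0 CP]].
have [[x0 x01]|noS] := pselect (exists x : X, `|x| = 1); last first.
  by exists 0 => x y x1; case: noS; exists x.
have [e [riesz ext]] := euclidean_extremals fd.
have [u [v [u1 v1 ev]]] := ext x0 x01.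
have S0 (z : X) : `|z| = 1 -> 0 < e z z.
  by move=> z1; rewrite dot_gt0// -normr_gt0 z1.
have eu := S0 u u1; have evv := S0 v v1.
pose k := Num.sqrt (e v v / e u u).
have k0 : 0 < k by rewrite sqrtr_gt0 divr_gt0.
pose c' := c / (1 + 2 * c); pose C' := 4 * C + 1.
have d0 : 0 < 1 + 2 * c by lra.
have c'0 : 0 < c' by rewrite divr_gt0.
have C'0 : 0 < C' by rewrite /C'; lra.
(* Since [|H w| <= k |w|], this scale gives [C' |s H w|^2 <= c' |w|^2], matching the upper bound at
   [y] with the lower bound at [x]. *)
pose s := Num.sqrt (c' / C') / k.
have s0 : 0 < s by rewrite divr_gt0// sqrtr_gt0 divr_gt0.
have sC : C' * (s * k) ^+ 2 = c'.
  rewrite /s divfK ?gt_eqF// sqr_sqrtr ?divr_ge0 ?ltW//.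
  by rewrite mulrC divfK// gt_eqF.
clearbody s.
pose K : R := 1 + 2 * (s^-1 * k).
exists K => x y; rewrite /unit_sphere/= => x1 y1.
have [f [fle fx]] := norming_functional x fd; rewrite x1 in fx.
have [g [gle gy]] := norming_functional y fd; rewrite y1 in gy.
have [p fp] := riesz f (@bounded_op_linear _ _ _ f).
have [q gq] := riesz g (@bounded_op_linear _ _ _ g).
have p0 : p != 0.
  by apply/eqP => p0; move: fx; rewrite fp p0 linear0l => /esym/eqP; rewrite oner_eq0.
have q0 : q != 0.
  by apply/eqP => q0; move: gy; rewrite gq q0 linear0l => /esym/eqP; rewrite oner_eq0.
have [H [lH HK He Hpq Hqp]] := kernel_isometry e p0 q0.
have Hk z : `|H z| <= k * `|z|.
  rewrite -(@ler_pXn2r _ 2)// ?nnegrE ?mulr_ge0 ?(ltW k0)//.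
  rewrite exprMn sqr_sqrtr ?divr_ge0 ?(ltW eu) ?(ltW evv)//.
  rewrite [leRHS]mulrAC ler_pdivlMr// mulrC.
  have /andP[h _] := ev (H z); have /andP[_ h'] := ev z.
  by rewrite (le_trans h)// He.
(* All data are parameters because the inverse has the same shape, with [f] and [g], [x] and [y]
   exchanged and [s] inverted. *)
pose tau (f1 : dual X) (x1 y1 : X) (s1 : R) (z : X) : X :=
  (f1 z : R) *: y1 + s1 *: H (z - (f1 z : R) *: x1).
have tau_linear f1 x' y' s1 : linear (tau f1 x' y' s1).
  move=> a z w; rewrite /tau.
  have -> : (f1 (a *: z + w) : R) = a * f1 z + f1 w by exact: bounded_op_linear.
  have -> : a *: z + w - (a * f1 z + f1 w) *: x' =
      a *: (z - (f1 z : R) *: x') + (w - (f1 w : R) *: x').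
    by rewrite scalerBr scalerA scalerDl opprD addrACA.
  rewrite lH !scalerDr scalerDl !scalerA (mulrC s1 a) addrACA.
  by [].
pose op f1 x' y' s1 : bounded_op X X := BoundedOp (introT (bounded_linearP _)
  (linear_is_bounded_linear fd (tau_linear f1 x' y' s1))).
have ker (f1 : dual X) (x' z : X) : f1 x' = 1 -> f1 (z - (f1 z : R) *: x') = 0.
  move=> f1x; rewrite addrC -scaleNr bounded_op_linear f1x.
  by rewrite [_ *: _]mulr1 addNr.
have tauK (f1 g1 : dual X) (x' y' : X) (s1 : R) : s1 != 0 ->
    f1 x' = 1 -> g1 y' = 1 ->
    (forall z, f1 z = 0 -> g1 (H z) = 0) ->
    (forall z, g1 (tau f1 x' y' s1 z) = f1 z) /\
    cancel (tau f1 x' y' s1) (tau g1 y' x' s1^-1).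
  move=> s10 f1x g1y fg.
  have gT z : g1 (tau f1 x' y' s1 z) = f1 z.
    rewrite /tau bounded_op_linear bounded_opZ g1y fg ?ker//.
    by rewrite scaler0 addr0 [_ *: _]mulr1.
  split=> // z; rewrite {1}/tau gT.
  have -> : tau f1 x' y' s1 z - (f1 z : R) *: y' = s1 *: H (z - (f1 z : R) *: x').
    by rewrite /tau addrC addKr.
  have HZ a w : H (a *: w) = a *: H w.
    have H0 : H 0 = 0.
      by have := lH 1 0 0; rewrite !scale1r addr0 -[LHS]addr0 => /addrI.
    by have := lH a w 0; rewrite H0 !addr0.
  by rewrite HZ HK scalerA mulVf// scale1r addrC subrK.
have fg z : f z = 0 -> g (H z) = 0 by rewrite fp gq; exact: Hpq.
have gf z : g z = 0 -> f (H z) = 0 by rewrite fp gq; exact: Hqp.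
have sN0 : s != 0 by rewrite gt_eqF.
have [gT TU] := tauK f g x y s sN0 fx gy fg.
have [_ UT] := tauK g f y x s^-1 (invr_neq0 sN0) gy fx gf.
rewrite invrK in UT.
exists (op f x y s); split.
- split; first by exists (op g y x s^-1).
  apply: op_norm_le => z z1 /=.
  rewrite -(@ler_pXn2r _ 2)// ?nnegrE// expr1n.
  (* As [g] takes the value [f z] on the image, only the kernel components remain to be compared. *)
  have := smooth_support_upper y1 gy gle C0 CP (tau f x y s z).
  rewrite gT; move/le_trans; apply.
  have -> : tau f x y s z - (f z : R) *: y = s *: H (z - (f z : R) *: x).
    by rewrite /tau addrC addKr.
  have zz : `|z| ^+ 2 <= 1 by rewrite expr_le1.
  apply: le_trans zz.
  apply: le_trans (convex_support_lower x1 fx fle c0 cP z).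
  rewrite lerD2l -/c' -/C' -sC -mulrA ler_pM2l// -exprMn.
  rewrite lerXn2r ?nnegrE ?(mulr_ge0 (mulr_ge0 (ltW s0) (ltW k0)))//.
  by rewrite normrZ gtr0_norm// -mulrA ler_pM2l.
- rewrite /= /tau fx !scale1r subrr.
  have -> : H 0 = 0.
    by have := lH 1 0 0; rewrite !scale1r addr0 -[LHS]addr0 => /addrI.
  by rewrite scaler0 addr0.
exists (op g y x s^-1); first by split.
apply: op_norm_le => z z1 /=; rewrite /tau.
have gz : `|g z : R^o| <= 1 by exact: le_trans (gle z) z1.
have wz : `|z - (g z : R) *: y| <= 2.
  rewrite (le_trans (ler_normB _ _))// normrZ y1 mulr1.
  have : `|g z : R| <= 1 by [].
  by lra.
rewrite (le_trans (ler_normD _ _))// /K lerD//.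
  by rewrite normrZ x1 mulr1.
rewrite normrZ gtr0_norm ?invr_gt0// mulrCA ler_pM2l ?invr_gt0//.
by rewrite (le_trans (Hk _))// mulrC ler_pM2r.
Qed.

Theorem proposition3p1 (R : realType) (X : normedModType R)
    (fdX : finite_dimensional X) :
  [<-> boundedly_semitransitive X;
       boundedly_semitransitive (dual X);
       exists lambda : R, forall x : X, unit_sphere X x ->
         exists E F : set X,
           [/\ inner_ellipsoid x E, outer_ellipsoid x F &
               F `<=` [set lambda *: y | y in E]];
       convexity_power_type2 X /\ smoothness_power_type2 X].
Proof.
have fdX' := finite_dimensional_dual fdX.
have ad (Y : normedModType R) : finite_dimensional Y ->
    boundedly_semitransitive Y ->
    convexity_power_type2 Y /\ smoothness_power_type2 Y.
  move=> fdY /(semitransitive_uniform_ellipsoids fdY).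
  exact: uniform_ellipsoids_power_type2.
(* The implications (a) to (b) and (b) to (c) both pass through (d), which transfers between [X] and
   its dual. *)
tfae.
- move=> /(ad _ fdX)/dual_power_type2.
  exact: power_type2_semitransitive.
- move=> /(ad _ fdX')/(predual_power_type2 fdX) dX.
  apply: semitransitive_uniform_ellipsoids => //.
  exact: power_type2_semitransitive.
- exact: uniform_ellipsoids_power_type2.
- exact: power_type2_semitransitive.
Qed.
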